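(* Every right-angled Coxeter group (of finite or infinite rank) is rigid. That is, if $W$ is a right-angled Coxeter group and $S,S'\in\mathcal S(W)$ are any two Coxeter sets for $W$, then there exists $\alpha\in\mathrm{Aut}(W)$ with $\alpha(S)=S'$ (equivalently, the types of $(W,S)$ and $(W,S')$ are isomorphic matrices).
   Context: A Coxeter set for a group $W$ is a generating subset $S\subseteq W$ (possibly infinite) consisting of elements of order $2$ such that, writing $m_{s,t}$ for the order of $st$ in $W$ ($s,t\in S$), $W$ has the presentation $\langle S\mid (st)^{m_{s,t}}=1 \text{ for } s,t\in S \text{ with } m_{s,t}\neq\infty\rangle$. Then $(W,S)$ is a Coxeter system, the matrix $(m_{s,t})_{s,t\in S}$ is its type, and $W$ is a Coxeter group; $\mathcal S(W)$ is the set of Coxeter sets for $W$. An isomorphism of types $(m_{s,t})_{s,t\in S}\to(m'_{s',t'})_{s',t'\in S'}$ is a bijection $f:S\to S'$ with $m'_{f(s),f(t)}=m_{s,t}$ for all $s,t$. The Coxeter system $(W,S)$ is right-angled if all $m_{s,t}\in\{1,2,\infty\}$; a Coxeter group $W$ is right-angled if it admits a right-angled Coxeter system (then all its Coxeter systems are right-angled). A Coxeter group is rigid if all types it admits are isomorphic, i.e. if for all $S,S'\in\mathcal S(W)$ there is $\alpha\in\mathrm{Aut}(W)$ with $\alpha(S)=S'$. *)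

(* Defs.v *)
From HB Require Import structures.
From mathcomp Require Import all_boot.
From mathcomp Require Import boolp classical_sets.

Set Implicit Arguments.
Unset Strict Implicit.
Unset Printing Implicit Defensive.

Local Open Scope classical_set_scope.
Local Open Scope group_scope.

(* Group words over X: the letter (x, true) stands for x and (x, false) for
   the formal inverse of x. *)
Definition word (X : Type) : Type := seq (X * bool).

Definition letter_eval (G : groupType) (X : Type) (e : X -> G)
  (l : X * bool) : G := if l.2 then e l.1 else (e l.1)^-1.

Definition word_eval (G : groupType) (X : Type) (e : X -> G) (w : word X) : G :=
  \prod_(l <- w) letter_eval e l.

(* The group <X | R> is the quotient of the words by this congruence: two words
   are equivalent iff they differ, in the free group on X, by an element of the
   normal closure of R. *)
Inductive word_equiv (X : Type) (R : set (word X)) : word X -> word X -> Prop :=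
| word_equiv_refl u : word_equiv R u u
| word_equiv_sym u v : word_equiv R u v -> word_equiv R v u
| word_equiv_trans u v w :
    word_equiv R u v -> word_equiv R v w -> word_equiv R u w
| word_equiv_cat u u' v v' :
    word_equiv R u u' -> word_equiv R v v' -> word_equiv R (u ++ v) (u' ++ v')
| word_equiv_cancel x b : word_equiv R [:: (x, b); (x, ~~ b)] [::]
| word_equiv_rel r : R r -> word_equiv R r [::].

(* G has the presentation <X | R> via e : X -> G: evaluation of words induces
   a bijection (hence a group isomorphism) from <X | R> onto G. *)
Definition has_presentation (G : groupType) (X : Type) (e : X -> G)
    (R : set (word X)) : Prop :=
  (forall g : G, exists w : word X, word_eval e w = g) /\
  (forall u v : word X, word_eval e u = word_eval e v <-> word_equiv R u v).

(* The order of a group element; None encodes infinite order. *)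
Definition elt_order (G : groupType) (g : G) : option nat :=
  if pselect (exists n : nat, (0 < n)%N && (g ^+ n == 1)) is left ex
  then Some (ex_minn ex) else None.

Definition coxeter_type (W : groupType) (S : set W) (s t : set_type S) :
  option nat := elt_order (val s * val t).

Definition coxeter_relators (W : groupType) (S : set W) :
    set (word (set_type S)) :=
  [set r | exists (s t : set_type S) (m : nat),
     coxeter_type s t = Some m /\
     r = flatten (nseq m [:: (s, true); (t, true)])].

(* That S generates W is the surjectivity part of has_presentation. *)
Definition coxeter_set (W : groupType) (S : set W) : Prop :=
  (forall s : W, S s -> elt_order s = Some 2%N) /\
  has_presentation (fun s : set_type S => val s) (@coxeter_relators W S).

Definition right_angled_set (W : groupType) (S : set W) : Prop :=
  forall s t : set_type S,
    [\/ coxeter_type s t = Some 1%N, coxeter_type s t = Some 2%N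
      | coxeter_type s t = None].

Definition right_angled_coxeter_group (W : groupType) : Prop :=
  exists S : set W, coxeter_set S /\ right_angled_set S.

Definition types_isomorphic (W : groupType) (S S' : set W) : Prop :=
  exists f : set_type S -> set_type S', bijective f /\
    forall s t : set_type S, coxeter_type (f s) (f t) = coxeter_type s t.

Definition automorphic_sets (W : groupType) (S S' : set W) : Prop :=
  exists alpha : {multiplicative W -> W}, bijective alpha /\ alpha @` S = S'.

Definition rigid (W : groupType) : Prop :=
  forall S S' : set W, coxeter_set S -> coxeter_set S' -> automorphic_sets S S'.

(* Main.v *)
Require Import Defs.
From HB Require Import structures.
From mathcomp Require Import all_boot ssralg ssrnum ssrint zify ring.
From mathcomp Require Import boolp classical_sets functions cardinality.
From mathcomp Require wochoice.

Set Implicit Arguments.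
Unset Strict Implicit.
Unset Printing Implicit Defensive.

Local Open Scope classical_set_scope.
Local Open Scope group_scope.

(** For a right-angled Coxeter set [S], the parity of the number of occurrences
    of a generator gives homomorphisms [W -> bool], the coordinates of the
    [F_2]-vector space [V], the abelianization of [W], in the basis [S].  An
    element of [V] is the image of an involution exactly when its support in [S]
    consists of pairwise commuting generators.  Hence the set [I] of such images
    and the sets [N x] of those [y] in [I] with [x + y] in [I] depend on [W]
    alone, while two generators [s], [t] commute iff [t] lies in [N s].

    If [z] is in [I] and [t] is in the support of [z] then [N z] is contained in
    [N t].  So, given two right-angled Coxeter sets [S] and [S'], the change of
    basis matrices are block triangular for inclusion of the sets [N], and for
    each [A] the diagonal blocks, indexed by the [s] with [N s = A] and the [s']
    with [N s' = A], are mutually inverse.  The two index sets thus have the same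
    cardinality, and gluing bijections between them preserves commutation.

    That every Coxeter set is right-angled follows from the fact that elements
    of finite order have square [1]: the geometric representation of [W] is
    faithful and trivial modulo 2, so Minkowski's argument applies. *)

(** * Linear independence over F_2 and cardinality *)

Lemma well_ordering_total (T : eqType) : exists R : rel T,
  [/\ reflexive R, antisymmetric R, transitive R, total R
    & forall P : set T, P !=set0 -> exists2 z, P z & forall x, P x -> R z x].
Proof.
have [R wo] := wochoice.well_ordering_principle T.
have minR (P : set T) : P !=set0 -> exists2 z, P z & forall x, P x -> R z x.
  case=> x Px; have [|z [[Pz minz] _]] := wo [pred x | `[< P x >]].
    by exists x; apply/asboolP.
  by exists z => [|y Py]; [apply/asboolP | apply/minz/asboolP].
have wc : wochoice.wo_chain R predT by move=> A _; apply: wo.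
have antiR : antisymmetric R.
  by move=> x y; apply: (wochoice.wo_chain_antisymmetric wc).
exists R; split=> //.
- by move=> x; apply: (wochoice.wo_chain_reflexive wc).
(* Transitivity is read off the least element of [{x, y, z}]. *)
- move=> y x z Rxy Ryz; have [|m mE minm] := minR [set w | [\/ w = x, w = y | w = z]].
    by exists x; constructor 1.
  have mx := minm x (Or31 _ _ erefl).
  have my := minm y (Or32 _ _ erefl); have mz := minm z (Or33 _ _ erefl).
  case: mE => mE; subst m => //; first by rewrite (antiR x y) ?Rxy.
  by rewrite (antiR z y) ?my.
- by move=> x y; apply: (wochoice.wo_chainW wc).
Qed.

Lemma seq_maximum (T : eqType) (R : rel T) (P : set T) (s : seq T) :
  reflexive R -> transitive R -> total R -> (forall x, P x -> x \in s) -> P !=set0 ->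
  exists2 m, P m & forall x, P x -> R x m.
Proof.
move=> Rxx Rtr Rtot Ps [x0 Px0].
suff H (r : seq T) : exists2 m, P m & forall x, x \in r -> P x -> R x m.
  by have [m Pm mP] := H s; exists m => // x Px; apply: mP => //; apply: Ps.
elim: r => [|y r [m Pm mP]]; first by exists x0.
have [Py|nPy] := pselect (P y); last first.
  by exists m => // x; rewrite inE => /predU1P[-> //|]; apply: mP.
have [Rmy|nRmy] := boolP (R m y).
  by exists y => // x; rewrite inE => /predU1P[-> //|xr Px]; apply: Rtr Rmy; apply: mP.
exists m => // x; rewrite inE => /predU1P[-> _|]; last exact: mP.
by have := Rtot m y; rewrite (negbTE nRmy).
Qed.

Section F2Independence.
Variables (X Y : eqType) (v : X -> Y -> bool).

Definition f2_sum (l : seq X) (y : Y) := \big[addb/false]_(x <- l) v x y.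

Lemma f2_sum_cat l l' y : f2_sum (l ++ l') y = f2_sum l y (+) f2_sum l' y.
Proof. by rewrite /f2_sum big_cat. Qed.

(* Gaussian elimination along well-orders of [X] and [Y]: [x] is sent to the
   least leading index of a vector in the coset of [v x] modulo the span of the
   earlier vectors. *)
Lemma f2_independent_card_le (A : set X) (B : set Y) :
  (forall x, exists s : seq Y, forall y, v x y -> y \in s) ->
  (forall x l, A x -> (forall z, z \in l -> A z) -> x \notin l ->
     exists2 y, B y & f2_sum (x :: l) y) ->
  (A #<= B)%card.
Proof.
move=> fin_v indep.
have [R [Rxx Ranti Rtr Rtot minR]] := well_ordering_total Y.
have [L [_ Lanti Ltr Ltot _]] := well_ordering_total X.
pose below x (l : seq X) := forall z, z \in l -> [/\ A z, L z x & z != x].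
(* The leading index is the [R]-greatest index in [B] where the sum is nonzero; finiteness of
   supports makes it exist. *)
pose lead l y := [/\ B y, f2_sum l y & forall z, B z -> f2_sum l z -> R z y].
have fin_sum l : exists s : seq Y, forall y, f2_sum l y -> y \in s.
  elim: l => [|x l [s sP]]; first by exists [::] => y; rewrite /f2_sum big_nil.
  have [r rP] := fin_v x; exists (r ++ s) => y; rewrite /f2_sum big_cons mem_cat.
  case: (boolP (v x y)) => [/rP -> //|_]; rewrite addFb => yl.
  by rewrite [y \in s]sP ?orbT.
have lead_ex x l : A x -> below x l -> exists y, lead (x :: l) y.
  move=> Ax bl; have [y By yl] : exists2 y, B y & f2_sum (x :: l) y.
    by apply: indep => // [z /bl[]//|]; apply/negP => /bl[_ _]; rewrite eqxx.
  have [s sP] := fin_sum (x :: l).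
  have [||m [Bm ml] mP] := @seq_maximum _ R [set y | B y /\ f2_sum (x :: l) y] s Rxx Rtr Rtot.
  - by move=> z [_ /sP].
  - by exists y.
  by exists m; split=> // z Bz zl; apply: mP.
pose Q x := [set y | exists2 l, below x l & lead (x :: l) y].
(* A point of [A] supplies an index to serve as the value of [f] outside [A]. *)
have [->|/set0P[x0 Ax0]] := eqVneq A set0; first exact: card_ge0.
have below0 x : below x [::] by [].
have /choice[f fP] x : exists y, A x -> Q x y /\ forall z, Q x z -> R y z.
  have [Ax|nAx] := pselect (A x); last first.
    by have [y _] := lead_ex _ _ Ax0 (below0 x0); exists y.
  have [|y Qy minQ] := minR (Q x); last by exists y.
  by have [y ly] := lead_ex _ _ Ax (below0 x); exists y, [::].
(* If [f x' = f x], the sum of the two minimal vectors is still in the coset of [x], but the common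
   leading index cancels, leaving a smaller one against minimality. *)
have less x x' : A x -> A x' -> L x' x -> x' != x -> f x' != f x.
  move=> Ax Ax' lt ne; apply/eqP => ff.
  have [[l bl [Bf lf maxl]] minf] := fP x Ax.
  have [[l' bl' [_ lf' maxl']] _] := fP x' Ax'; rewrite ff in lf' maxl'.
  have bl2 : below x (l ++ x' :: l').
    move=> z; rewrite mem_cat inE => /orP[/bl//|/predU1P[->//|/bl'[Az zx' nzx']]].
    split=> //; first exact: Ltr zx' lt.
    by apply: contraNneq ne => zx; rewrite eq_sym -zx; apply/eqP/Lanti; rewrite zx' zx lt.
  have [y [By ly maxy]] := lead_ex _ _ Ax bl2.
  have Rfy : R (f x) y by apply: minf; exists (l ++ x' :: l').
  have sumE z : f2_sum (x :: l ++ x' :: l') z = f2_sum (x :: l) z (+) f2_sum (x' :: l') z.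
    by rewrite -cat_cons f2_sum_cat.
  have Ryf : R y (f x).
    move: ly; rewrite sumE; case: (boolP (f2_sum (x :: l) y)) => [lx _|_ /= lx'].
      exact: maxl.
    exact: maxl'.
  by move: ly; rewrite (Ranti y (f x)) ?Ryf ?Rfy // sumE lf lf'.
have funf : set_fun A B f by move=> x Ax; have [[l _ []]] := fP x Ax.
have injf : set_inj A f.
  move=> x x' /set_mem Ax /set_mem Ax' ff; apply/eqP; apply: contraT => ne.
  have /orP[le|le] := Ltot x x'.
    by have := less _ _ Ax' Ax le ne; rewrite ff eqxx.
  by have := less _ _ Ax Ax' le; rewrite eq_sym ne ff eqxx => /(_ isT).
by have [g] : $|{injfun A >-> B}|; [apply/injfunPex; exists f | apply: inj_card_le].
Qed.

End F2Independence.

Lemma card_eq_fibers_bijection (I J L : Type) (cI : I -> L) (cJ : J -> L) :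
  (forall l, (cI @^-1` [set l] #= cJ @^-1` [set l])%card) ->
  exists2 f : I -> J, bijective f & forall i, cJ (f i) = cI i.
Proof.
elim/Ppointed: J => J in cJ *.
  move=> eqc; have noI (i : I) : False.
    have /card_bijP[f _] := eqc (cI i).
    exact: no (val (f (SigSub (mem_set (erefl : (cI @^-1` [set cI i]) i))))).
  exists (fun i => False_rect _ (noI i)) => [|i]; last by case: (noI i).
  by exists (fun j => False_rect _ (no j)) => [i|j]; [case: (noI i) | case: (no j)].
move=> /(_ _)/card_set_bijP-/choice[F bijF].
have funF i : cJ (F (cI i) i) = cI i by have [+ _ _] := bijF (cI i); apply.
exists (fun i => F (cI i) i) => //; rewrite -setTT_bijective; split=> //.
  move=> i i' _ _ /= ff; have cc : cI i = cI i' by rewrite -(funF i) ff funF.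
  have [_ injF _] := bijF (cI i).
  by apply: injF; rewrite ?inE //= {2}cc.
move=> j _; have [_ _ /(_ j erefl)[i ci <-]] := bijF (cJ j).
by exists i => //; rewrite ci.
Qed.

(** * Homomorphisms to F_2 and classes of involutions *)

Section Parity.
Variable W : groupType.
Implicit Types (g h x y z : W) (phi : W -> bool).

Definition parity_hom phi := forall g h, phi (g * h) = phi g (+) phi h.

(** Equality in [V], expressed without a quotient and without reference to a Coxeter set. *)
Definition same_parity g h := forall phi, parity_hom phi -> phi g = phi h.

(* The image of [g] in [V] lies in the set [I] of the introduction; [compatible]
   is the [N] there. *)
Definition involutive_class g := exists2 h, h * h = 1 & same_parity g h.

Definition compatible x : set W :=
  [set y | involutive_class y /\ involutive_class (x * y)].

Lemma parity_hom1 phi : parity_hom phi -> phi 1 = false.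
Proof. by move=> hom; have := hom 1 1; rewrite mulg1; case: (phi 1). Qed.

Lemma parity_hom_prod phi (I : Type) (l : seq I) (F : I -> W) : parity_hom phi ->
  phi (\prod_(i <- l) F i) = \big[addb/false]_(i <- l) phi (F i).
Proof. by move=> hom; apply: big_morph; [apply: hom | apply: parity_hom1]. Qed.

Lemma invol_involutive_class h : h * h = 1 -> involutive_class h.
Proof. by exists h. Qed.

Lemma compatibleC x y : involutive_class x -> compatible x y -> compatible y x.
Proof.
move=> ix [_ [h hh par]]; split=> //; exists h => // phi hom.
by rewrite -par // !hom addbC.
Qed.

Lemma big_addb_ex (I : eqType) (l : seq I) (F : I -> bool) :
  \big[addb/false]_(i <- l) F i -> exists2 i, i \in l & F i.
Proof.
elim: l => [|i l IH]; first by rewrite big_nil.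
rewrite big_cons; case: (boolP (F i)) => [Fi _|_]; first by exists i; rewrite ?mem_head.
by rewrite addFb => /IH[j jl Fj]; exists j => //; rewrite inE jl orbT.
Qed.

End Parity.

(** * Orders of products of involutions, words in Coxeter generators *)

Section EltOrder.
Variable G : groupType.
Implicit Types g s t : G.

Lemma elt_order_gt0 g m : elt_order g = Some m -> (0 < m)%N /\ g ^+ m = 1.
Proof.
rewrite /elt_order; case: pselect => // ex [<-].
by case: ex_minnP => k /andP[k0 /eqP].
Qed.

Lemma elt_order_min g m k :
  elt_order g = Some m -> (0 < k)%N -> g ^+ k = 1 -> (m <= k)%N.
Proof.
rewrite /elt_order; case: pselect => // ex [<-] k0 gk.
by case: ex_minnP => j _; apply; rewrite k0 gk eqxx.
Qed.

Lemma elt_orderP g m : (0 < m)%N -> g ^+ m = 1 ->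
  (forall k, (0 < k < m)%N -> g ^+ k <> 1) -> elt_order g = Some m.
Proof.
move=> m0 gm min_m; case E: (elt_order g) => [j|].
  have [j0 gj] := elt_order_gt0 E; have jm := elt_order_min E m0 gm.
  congr Some; apply/eqP; rewrite eqn_leq jm leqNgt.
  by apply/negP => ltjm; apply: (min_m j) => //; rewrite j0.
move: E; rewrite /elt_order; case: pselect => // -[]; exists m.
by rewrite m0 gm eqxx.
Qed.

Lemma elt_order2 g : elt_order g = Some 2%N -> g * g = 1 /\ g <> 1.
Proof.
move=> E; have [_] := elt_order_gt0 E; rewrite expgS expg1 => gg; split=> // g1.
by have := elt_order_min E (isT : (0 < 1)%N); rewrite expg1 => /(_ g1).
Qed.

Lemma invol_inv g : g * g = 1 -> g^-1 = g.
Proof. by move=> gg; rewrite -[RHS](mulKg g) gg mulg1. Qed.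

Lemma mul_invol_sq s t : s * s = 1 -> t * t = 1 ->
  ((s * t) ^+ 2 = 1 <-> s * t = t * s).
Proof.
move=> ss tt; rewrite expgS expg1; split=> [st2|st].
  by rewrite -(invol_inv st2) invgM (invol_inv ss) (invol_inv tt).
by rewrite {2}st mulgA -(mulgA s) tt mulg1.
Qed.

Lemma elt_order_mul_invol s t : s * s = 1 -> t * t = 1 ->
  (forall m, elt_order (s * t) = Some m -> (m <= 2)%N) ->
  elt_order (s * t) =
    if s == t then Some 1%N else if s * t == t * s then Some 2%N else None.
Proof.
move=> ss tt le2; case: eqP => [<-|st].
  by apply: elt_orderP => // -[|[]].
have st1 : s * t <> 1 by move=> e; apply: st; rewrite -[LHS]mulg1 -tt mulgA e mul1g.
case: eqP => [/(mul_invol_sq ss tt) c|c].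
  by apply: elt_orderP => // -[|[|]].
case E: elt_order => [m|] //; have [m0 stm] := elt_order_gt0 E.
have := le2 _ E; case: m m0 stm {E} => [|[|[|]]] //.
by move=> _ /(mul_invol_sq ss tt).
Qed.

End EltOrder.

Section WordEval.
Variables (G : groupType) (X : Type) (e : X -> G).

Lemma word_eval_nil : word_eval e [::] = 1.
Proof. by rewrite /word_eval big_nil. Qed.

Lemma word_eval_cat u v : word_eval e (u ++ v) = word_eval e u * word_eval e v.
Proof. by rewrite /word_eval big_cat. Qed.

Lemma word_eval_cons l u : word_eval e (l :: u) = letter_eval e l * word_eval e u.
Proof. by rewrite /word_eval big_cons. Qed.

End WordEval.

Section CoxeterSet.
Variables (W : groupType) (S : set W).
Hypothesis cS : coxeter_set S.
Implicit Types (s t : set_type S) (g h : W).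

Lemma coxeter_invol s : val s * val s = 1.
Proof. by have [] := elt_order2 (cS.1 (val s) (set_valP s)). Qed.

Lemma letter_eval_coxeter (l : set_type S * bool) :
  letter_eval (fun s : set_type S => val s) l = val l.1.
Proof. by rewrite /letter_eval; case: l.2 => //; rewrite (invol_inv (coxeter_invol _)). Qed.

Lemma coxeter_ind (P : W -> Prop) : P 1 ->
  (forall s g, P g -> P (val s * g)) -> forall g, P g.
Proof.
move=> P1 Ps g; have [w <-] := cS.2.1 g; elim: w => [|l w IH].
  by rewrite word_eval_nil.
by rewrite word_eval_cons letter_eval_coxeter; apply: Ps.
Qed.

(** Exponents of letters are ignored because generators will act by involutions. *)
Definition word_act Y (a : set_type S -> Y -> Y) (w : word (set_type S)) (y : Y) :=
  foldr (fun l => a l.1) y w.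

Lemma word_act_cat Y (a : set_type S -> Y -> Y) u v y :
  word_act a (u ++ v) y = word_act a u (word_act a v y).
Proof. by rewrite /word_act foldr_cat. Qed.

End CoxeterSet.

(** * Actions of right-angled Coxeter groups *)

(** This is the form that the torsion bound yields for an arbitrary Coxeter set. *)
Definition at_most2 (W : groupType) (S : set W) : Prop :=
  forall (s t : set_type S) m, coxeter_type s t = Some m -> (m <= 2)%N.

Lemma right_angled_at_most2 (W : groupType) (S : set W) :
  right_angled_set S -> at_most2 S.
Proof. by move=> rS s t m; case: (rS s t) => -> // [<-]. Qed.

Section RightAngled.
Variables (W : groupType) (S : set W).
Hypotheses (cS : coxeter_set S) (rS : at_most2 S).
Implicit Types (s t : set_type S) (g h : W).

Lemma coxeter_typeE s t : coxeter_type s t =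
  if s == t then Some 1%N else
  if val s * val t == val t * val s then Some 2%N else None.
Proof.
rewrite /coxeter_type (elt_order_mul_invol (coxeter_invol cS s) (coxeter_invol cS t)) //.
by move=> m; apply: rS.
Qed.

(** The universal property of the presentation: the relators are only [s s] and [s t s t] with [s],
    [t] commuting, and both act trivially. Hence a word chosen for [g] acts independently of the
    choice. *)
Lemma right_angled_action (Y : Type) (a : set_type S -> Y -> Y) :
  (forall s, involutive (a s)) ->
  (forall s t, s <> t -> val s * val t = val t * val s ->
     forall y, a s (a t y) = a t (a s y)) ->
  exists A : W -> Y -> Y,
    [/\ forall y, A 1 y = y, forall g h y, A (g * h) y = A g (A h y)
      & forall s y, A (val s) y = a s y].
Proof.
move=> inv_a com_a.
have act_equiv u v : word_equiv (@coxeter_relators W S) u v ->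
    forall y, word_act a u y = word_act a v y.
  elim=> {u v} [//|u v _ IH y|u v w _ IH1 _ IH2 y|u u' v v' _ IH1 _ IH2 y|x b y|r].
  - by rewrite IH.
  - by rewrite IH1.
  - by rewrite !word_act_cat IH2 IH1.
  - by rewrite /= inv_a.
  - case=> s [t [m [stm ->]]] y; move: stm; rewrite coxeter_typeE.
    case: eqP => [<- [<-]|st]; first by rewrite /= inv_a.
    by case: eqP => // c [<-]; rewrite /= -(com_a s t) // !inv_a.
have [word_of wordK] := choice cS.2.1.
have act_eval w y : word_act a (word_of (word_eval (fun s => val s) w)) y = word_act a w y.
  by apply: act_equiv; apply/cS.2.2; rewrite wordK.
exists (fun g => word_act a (word_of g)); split.
- by move=> y; rewrite -(word_eval_nil (fun s : set_type S => val s)) act_eval.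
- move=> g h y; rewrite -[in LHS](wordK g) -[in LHS](wordK h) -word_eval_cat.
  by rewrite act_eval word_act_cat.
- move=> s y; have -> : val s = word_eval (fun s : set_type S => val s) [:: (s, true)].
    by rewrite word_eval_cons word_eval_nil mulg1.
  by rewrite act_eval.
Qed.

(** * The geometric representation and torsion *)

Definition adj s t := val s * val t == val t * val s.

Lemma adjC s t : adj s t = adj t s.
Proof. by rewrite /adj eq_sym. Qed.

(* The geometric reflections, with bilinear form -1 on non-commuting pairs,
   in the action on linear forms, given by their values on the simple roots. *)
Definition tits_refl s (p : set_type S -> int) : set_type S -> int := fun t =>
  (if t == s then - p s else if adj s t then p t else p t + 2 * p s)%R.

Lemma tits_reflK s : involutive (tits_refl s).
Proof.
move=> p; apply/funext => t; rewrite /tits_refl eqxx.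
by case: eqP => [->|_]; [lia | case: (adj s t); lia].
Qed.

Lemma tits_reflC s t : s <> t -> adj s t ->
  forall p, tits_refl s (tits_refl t p) = tits_refl t (tits_refl s p).
Proof.
move=> /eqP st st' p; apply/funext => u; rewrite /tits_refl (eq_sym t s) (negbTE st).
rewrite (adjC t s) st'.
case: (u =P s) => [->|us]; first by rewrite (negbTE st) adjC st'.
by case: (u =P t) => [->|_]; [rewrite st' | case: (adj s u); case: (adj t u); lia].
Qed.

Section TitsAction.
Variable A : W -> (set_type S -> int) -> set_type S -> int.
Hypotheses (A1 : forall p, A 1 p = p)
  (AM : forall g h p, A (g * h) p = A g (A h p))
  (Agen : forall s p, A (val s) p = tits_refl s p).

(* Each letter is applied to a point on the positive side of its wall. *)
Inductive ascending : W -> (set_type S -> int) -> Prop :=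
| ascending1 : ascending 1 (fun=> 1%R)
| ascending_cons s g p : ascending g p -> (0 < p s)%R ->
    ascending (val s * g) (tits_refl s p).

Lemma ascending_act g p : ascending g p -> A g (fun=> 1%R) = p.
Proof. by elim=> [|s h q _ IH _]; rewrite ?A1 // AM IH Agen. Qed.

(** The sum condition makes the induction work: for [t] not commuting with [r], the new value
    [q t + 2 * q r] exceeds [q r > 0]. It also forces generators with negative values to commute. *)
Lemma ascending_inv g p : ascending g p ->
  (forall t, p t <> 0%R) /\
  (forall s t, s <> t -> ~~ adj s t -> (0 < p s + p t)%R).
Proof.
elim=> [|r h q _ [q0 qpos] r0]; first by split.
split=> [t|s t st nst]; rewrite /tits_refl.
  case: eqP => [_|tr]; first by lia.
  case: ifP => // /negbT nrt; have := @qpos r t; move: (q t) (q r) r0 => x y r0.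
  by move=> /(_ (fun e => tr (esym e)) nrt); lia.
have := qpos _ _ st nst.
case: eqP => [e|sr]; case: eqP => [e'|tr].
- by case: st; rewrite e e'.
- subst r; rewrite (negbTE nst). lia.
- by subst r; rewrite adjC (negbTE nst); lia.
- by case: ifP => _; case: ifP => _; lia.
Qed.

(** The exchange condition. If the outermost letter [s] is not [r], both have negative values, so
    they commute; then [r] is already negative one step earlier and can be moved past [s]. *)
Lemma ascending_exchange g p r : ascending g p -> (p r < 0)%R ->
  exists h q, ascending h q /\ g = val r * h.
Proof.
move=> asc; elim: asc r => [//|s h q asc_q IH qs] r pr.
have [rs|/eqP rs] := eqVneq r s; first by exists h, q; rewrite rs.
have [_ ppos] := ascending_inv (ascending_cons asc_q qs).
have sr : adj s r.
  apply: contraT => /(ppos s r (fun e => rs (esym e))).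
  by move: pr; rewrite /tits_refl !eqxx; lia.
move: (pr); rewrite {1}/tits_refl sr; case: eqP => // _ qr.
have [k [u [asc_u hk]]] := IH _ qr.
have qE : q = tits_refl r u.
  by rewrite -(ascending_act asc_q) hk AM (ascending_act asc_u) Agen.
exists (val s * k), (tits_refl s u); split; last first.
  by rewrite hk !mulgA (eqP sr).
apply: ascending_cons => //; move: qs; rewrite qE /tits_refl adjC sr.
by case: eqP => // e; case: rs.
Qed.

Lemma ascending_ex g : exists p, ascending g p.
Proof.
elim/(coxeter_ind cS): g => [|s g [p asc]]; first by exists (fun=> 1%R); constructor.
have [p0 _] := ascending_inv asc.
case: (boolP (0 < p s)%R) => ps; first by exists (tits_refl s p); constructor.
have ps' : (p s < 0)%R by have := p0 s; lia.
have [h [q [asc_h ->]]] := ascending_exchange asc ps'.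
by exists q; rewrite mulgA (coxeter_invol cS) mul1g.
Qed.

(** The constant form 1 detects [g]: after a nonempty ascending word the value at the last
    reflection applied is negative. *)
Lemma tits_faithful g : (forall p, A g p = p) -> g = 1.
Proof.
move=> gp; have [p asc] := ascending_ex g.
have := ascending_act asc; rewrite gp; case: asc => // s h q _ qs.
by move/(congr1 (fun f => f s)); rewrite /tits_refl eqxx; lia.
Qed.

Lemma tits_linear g (c : int) (p q : set_type S -> int) :
  A g (fun t => c * p t + q t)%R = (fun t => c * A g p t + A g q t)%R.
Proof.
elim/(coxeter_ind cS): g => [|s g IH]; first by rewrite !A1.
rewrite !AM IH !Agen; apply/funext => t; rewrite /tits_refl.
by case: eqP => // _; [ring | case: (adj s t); ring].
Qed.

Definition trivial_mod (m : int) g :=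
  forall p, exists q, A g p = (fun t => p t + m * q t)%R.

Lemma trivial_mod2 g : trivial_mod 2 g.
Proof.
elim/(coxeter_ind cS): g => [|s g IH] p.
  by exists (fun=> 0%R); rewrite A1; apply/funext => t; lia.
have [q Eq] := IH p; rewrite AM Agen Eq /tits_refl.
exists (fun t => if t == s then - p s - q s else if adj s t then q t
  else q t + (p s + 2 * q s))%R.
by apply/funext => t; case: eqP => [->|_]; [lia|case: ifP => _; lia].
Qed.

(** If [g = 1 + 2 X] then [g^2 = 1 + 4 (X + X^2)]. *)
Lemma trivial_mod4 g : trivial_mod 4 (g * g).
Proof.
move=> p; have [q Eq] := trivial_mod2 g p; have [r Er] := trivial_mod2 g q.
exists (fun t => q t + r t)%R.
rewrite AM {1}Eq; have := tits_linear g 2 q p.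
rewrite (_ : (fun t => (2 * q t + p t)%R) = (fun t => (p t + 2 * q t)%R)); last first.
  by apply/funext => t; lia.
by move=> ->; rewrite Eq Er; apply/funext => t; lia.
Qed.

Lemma tits_shift g (c : int) (p q : set_type S -> int) :
  A g (fun t => p t + c * q t)%R = (fun t => A g p t + c * A g q t)%R.
Proof.
have := tits_linear g c q p.
rewrite (_ : (fun t => c * q t + p t)%R = (fun t => p t + c * q t)%R).
  by move=> ->; apply/funext => t; rewrite GRing.addrC.
by apply/funext => t; rewrite GRing.addrC.
Qed.

Lemma tits_scale g (c : int) (p : set_type S -> int) :
  A g (fun t => c * p t)%R = (fun t => c * A g p t)%R.
Proof.
rewrite (_ : (fun t => c * p t)%R = (fun t => (c - 1) * p t + p t)%R).
  by rewrite tits_linear; apply/funext => t; ring.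
by apply/funext => t; ring.
Qed.

(* A form of Minkowski's argument: [g - 1] is divisible by all powers of 2. *)
Lemma trivial_mod_divisible g :
  (forall c : int, (c != 0)%R -> trivial_mod c g -> trivial_mod (2 * c)%R g) -> g = 1.
Proof.
move=> step; have div j : trivial_mod (2 ^+ j)%R g.
  elim: j => [|j IH]; last by rewrite GRing.exprS; apply: step => //; rewrite GRing.expf_neq0.
  by move=> p; exists (fun t => A g p t - p t)%R; apply/funext => t; ring.
apply: tits_faithful => p; apply/funext => t.
(* The exponent is the absolute value [n] of the entry itself: a nonzero multiple of [2 ^ n] would
   exceed [n]. *)
have [n nE] : exists n, n = `|(A g p t - p t)%R|%N by eexists.
have [q /(congr1 (fun f => f t)) /= Eq] := div n p.
have : n = (2 ^ n * `|q t|)%N.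
  by rewrite {1}nE Eq (_ : p t + _ - p t = 2 ^+ n * q t)%R ?abszM ?abszX //; ring.
have := ltn_expl n (isT : (1 < 2)%N).
case: (posnP `|q t|%N) => [->|q0] lt; first by rewrite muln0; lia.
by move=> E; rewrite ltnNge {2}E leq_pmulr in lt.
Qed.

(** If [g = 1 + c X], triviality mod 2 gives [g^i = 1 + c (i X + 2 Y_i)]; for [i = n] odd, [g^n = 1]
    makes [c X] divisible by [2 c]. *)
Lemma trivial_mod_odd_order n g : odd n -> g ^+ n = 1 -> g = 1.
Proof.
move=> odd_n gn; apply: trivial_mod_divisible => c _ cg p.
have [q Eq] := cg p; have [u Eu] := trivial_mod2 g q.
have pow i : exists r, A (g ^+ i) p = (fun t => p t + c * (i%:Z * q t + 2 * r t))%R.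
  elim: i => [|i [r Er]].
    by exists (fun=> 0%R); rewrite expg0 A1; apply/funext => t; ring.
  exists (fun t => i%:Z * u t + A g r t)%R; rewrite expgS AM Er tits_shift Eq.
  have -> : A g (fun t => i%:Z * q t + 2 * r t)%R =
            (fun t => i%:Z * (q t + 2 * u t) + 2 * A g r t)%R.
    by rewrite tits_shift tits_scale Eu.
  by apply/funext => t; rewrite intS; ring.
have [r] := pow n; rewrite gn A1 => /funeqP Er.
exists (fun t => - (r t + n./2%:Z * q t))%R; rewrite Eq; apply/funext => t.
have := Er t; have -> : (n%:Z = 1 + 2 * n./2%:Z)%R by lia.
move: (p t) (q t) (r t) (n./2%:Z)%R => x y z m E.
by rewrite [in RHS]E; ring.
Qed.

(** With [g p = p + c q] and [g q = q + 4 u], the relation [g^2 = 1] reads [2 c (q + 2 u) = 0], so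
    [q] is even. *)
Lemma trivial_mod4_invol g : trivial_mod 4 g -> g * g = 1 -> g = 1.
Proof.
move=> g4 gg; apply: trivial_mod_divisible => c c0 cg p.
have [q Eq] := cg p; have [u Eu] := g4 q.
have := AM g g p; rewrite gg A1 Eq tits_shift Eq Eu => /funeqP E.
exists (fun t => - u t)%R; apply/funext => t; have := E t => /= Et.
have : (c * (2 * (q t + 2 * u t)) = 0)%R.
  by rewrite -(GRing.subrr (p t)) [X in (_ = X - _)%R]Et; ring.
move/eqP; rewrite GRing.mulf_eq0 (negbTE c0) /= => /eqP qu.
have -> : (q t = - 2 * u t)%R by lia.
by ring.
Qed.

End TitsAction.

(** Induction on [n]: an odd exponent gives [g = 1]; for an even one, [g^2] has exponent [n / 2],
    hence is an involution trivial mod 4, hence 1. *)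
Lemma torsion_invol n g : (0 < n)%N -> g ^+ n = 1 -> g * g = 1.
Proof.
have [A [A1 AM Agen]] := right_angled_action tits_reflK
  (fun s t st c => tits_reflC st (introT eqP c)).
have [m] := ubnP n; elim: m n g => // m IH n g nm n0 gn.
have [odd_n|even_n] := boolP (odd n).
  by rewrite (trivial_mod_odd_order A1 AM Agen odd_n gn) mulg1.
apply: (trivial_mod4_invol A1 AM Agen); first exact: trivial_mod4.
apply: (IH n./2); [lia | lia | ].
rewrite -[g * g](expgS g 1) -expgnA -[RHS]gn; congr (_ ^+ _); lia.
Qed.

(** * Coordinates of the abelianization *)

(** On [bool], [s] acts by negation and the other generators trivially. *)
Lemma coordinate_ex s : exists phi, parity_hom phi /\ forall t, phi (val t) = (t == s).
Proof.
have [||A [A1 AM Agen]] := @right_angled_action bool (fun t b => (t == s) (+) b).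
- by move=> t b; rewrite addKb.
- by move=> t u _ _ b; rewrite addbCA.
have Aaddb g b : A g b = A g false (+) b.
  elim/(coxeter_ind cS): g b => [|t g IH] b; first by rewrite !A1.
  by rewrite !AM !Agen IH addbA.
exists (fun g => A g false); split=> [g h|t]; first by rewrite AM Aaddb.
by rewrite Agen addbF.
Qed.

Definition coordinate s : W -> bool := sval (cid (coordinate_ex s)).

Lemma coordinate_hom s : parity_hom (coordinate s).
Proof. by rewrite /coordinate; case: cid => phi []. Qed.

Lemma coordinate_gen s t : coordinate s (val t) = (t == s).
Proof. by rewrite /coordinate; case: cid => phi []. Qed.

Lemma coordinate_support g : exists l : seq (set_type S),
  [/\ uniq l, forall s, coordinate s g = (s \in l)
    & forall phi, parity_hom phi -> phi g = \big[addb/false]_(s <- l) phi (val s)].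
Proof.
elim/(coxeter_ind cS): g => [|s g [l [uniq_l lP phi_l]]].
  exists [::]; split=> // [s|phi hom]; first by rewrite parity_hom1 //; apply: coordinate_hom.
  by rewrite big_nil parity_hom1.
have [sl|sl] := boolP (s \in l).
  exists (rem s l); split; first exact: rem_uniq.
    move=> t; rewrite coordinate_hom coordinate_gen lP mem_rem_uniq // !inE eq_sym.
    by case: eqP => // ->; rewrite sl.
  move=> phi hom; rewrite hom phi_l // (perm_big _ (perm_to_rem sl)) big_cons.
  by rewrite addKb.
exists (s :: l); split=> [|t|phi hom]; first by rewrite /= sl.
  rewrite coordinate_hom coordinate_gen lP inE eq_sym.
  by case: eqP => // ->; rewrite (negbTE sl).
by rewrite hom phi_l // big_cons.
Qed.

Lemma prod_adj_invol (l : seq (set_type S)) :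
  (forall s t, s \in l -> t \in l -> adj s t) ->
  (\prod_(s <- l) val s) * (\prod_(s <- l) val s) = 1.
Proof.
elim: l => [|s l IH] adj_l; first by rewrite big_nil mulg1.
rewrite big_cons; set p := \prod_(t <- l) val t.
have pp : p * p = 1 by apply: IH => t u tl ul; apply: adj_l; rewrite inE ?tl ?ul orbT.
have sp : val s * p = p * val s.
  rewrite /p big_seq; apply: commute_prod => t tl.
  by apply/eqP/adj_l; rewrite inE ?tl ?eqxx ?orbT.
by rewrite {1}sp mulgA -(mulgA p) (coxeter_invol cS) mulg1.
Qed.

(* If [s] and [t] do not commute, the other generators die in the infinite
   dihedral group of isometries of the integers generated by [x |-> - x] and
   [x |-> 1 - x], and [h] becomes a translation of odd length. *)
Lemma invol_adj h s t : h * h = 1 -> coordinate s h -> coordinate t h -> adj s t.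
Proof.
move=> hh hs ht; apply: contraT => nst.
pose a (u : set_type S) (x : int) :=
  (if u == s then - x else if u == t then 1 - x else x)%R.
have [||A [A1 AM Agen]] := @right_angled_action int a.
- by move=> u x; rewrite /a; case: (u == s); [|case: (u == t)]; lia.
- move=> u w uw /eqP adj_uw x; rewrite /a.
  have us_wt : ~ (u = s /\ w = t) by case=> us wt; rewrite /adj -us -wt adj_uw in nst.
  have ut_ws : ~ (u = t /\ w = s) by case=> ut ws; rewrite adjC /adj -ut -ws adj_uw in nst.
  case: (u =P s) => us; case: (w =P s) => ws //; last first.
  + by case: (u =P t) => ut; case: (w =P t).
  + by case: (u =P t) => // ut; case: ut_ws.
  + by case: (w =P t) => // wt; case: us_wt.
(* The sign counts occurrences of [s] and [t] together, while the parity of the translation part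
   counts those of [t]. *)
have Aform g : exists c : int, odd `|c|%N = coordinate t g /\ forall x,
    A g x = ((if coordinate s g (+) coordinate t g then - x else x) + c)%R.
  elim/(coxeter_ind cS): g => [|u g [c [odd_c Ag]]].
    exists 0%R; split=> [|x]; rewrite ?A1 !parity_hom1 ?GRing.addr0 //;
      exact: coordinate_hom.
  have st : (s == t) = false by apply: contraNF nst => /eqP->; rewrite /adj.
  exists (a u c); rewrite !coordinate_hom !coordinate_gen -odd_c /a; split.
    case: (u =P s) => [->|_]; first by rewrite st addFb; lia.
    by case: (u =P t) => [_|_]; lia.
  move=> x; rewrite AM Ag Agen -odd_c /a; case: (u =P s) => [->|_].
    by rewrite st; move: (coordinate s g) (odd _) => [] [] /=; lia.
  by case: (u =P t) => _; move: (coordinate s g) (odd _) => [] [] /=; lia.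
have [c [odd_c Ah]] := Aform h.
by have := AM h h 0%R; rewrite hh A1 !Ah hs ht /=; rewrite ht in odd_c; lia.
Qed.

(** Conversely to [invol_adj], the product of the commuting generators in the support is an
    involution in the class of [g]. *)
Lemma involutive_classP g :
  involutive_class g <-> forall s t, coordinate s g -> coordinate t g -> adj s t.
Proof.
split=> [[h hh par] s t|adj_g].
  by rewrite !par; [apply: invol_adj | apply: coordinate_hom | apply: coordinate_hom].
have [l [_ lP phi_l]] := coordinate_support g.
exists (\prod_(s <- l) val s); last by move=> phi hom; rewrite phi_l // parity_hom_prod.
by apply: prod_adj_invol => s t; rewrite -!lP; apply: adj_g.
Qed.

Lemma compatible_coordinate z t :
  involutive_class z -> coordinate t z -> compatible z `<=` compatible (val t).
Proof.
move=> /involutive_classP Iz tz y [Iy /involutive_classP Izy]; split=> //.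
have {}Iy := (involutive_classP y).1 Iy.
(* If [t] is not in the support of [y] and [b] is not in that of [z], both lie in the support of
   [z * y]. *)
have ty b : coordinate b y -> adj t b.
  move=> yb; have [yt|yt] := boolP (coordinate t y); first exact: Iy.
  have [zb|zb] := boolP (coordinate b z); first exact: Iz.
  by apply: Izy; rewrite coordinate_hom ?tz ?(negbTE yt) ?(negbTE zb).
apply/involutive_classP => a b; rewrite !coordinate_hom !coordinate_gen.
case: eqP => [<-|_]; case: eqP => [<-|_] //=.
- by rewrite /adj.
- by move=> _; apply: ty.
- by move=> ya _; rewrite adjC; apply: ty.
- exact: Iy.
Qed.

Lemma adj_compatible s t : adj s t <-> compatible (val s) (val t).
Proof.
split=> [st|[_ /involutive_classP Ist]]; last first.
  have [->|st] := eqVneq s t; first by rewrite /adj.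
  by apply: Ist; rewrite coordinate_hom !coordinate_gen eqxx ?(negbTE st) // eq_sym (negbTE st).
split; first exact/invol_involutive_class/coxeter_invol.
apply: invol_involutive_class.
by rewrite {1}(eqP st) mulgA -(mulgA (val t)) (coxeter_invol cS) mulg1 (coxeter_invol cS).
Qed.

End RightAngled.

(** * Comparison of two Coxeter sets *)

Section TwoCoxeterSets.
Variables (W : groupType) (S S' : set W).
Hypotheses (cS : coxeter_set S) (rS : at_most2 S).
Hypotheses (cS' : coxeter_set S') (rS' : at_most2 S').

(** The [x]-coordinate of [g] is 1, so some [t] in the [S']-support of [g] has [x] in its
    [S]-support, whence [N t] is inside [N x = A]. This [t] also occurs in some [s] of [x :: l],
    whence [A = N s] is inside [N t]. *)
Lemma compatible_class_card_le (A : set W) :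
  ([set s : set_type S | compatible (val s) = A] #<=
   [set t : set_type S' | compatible (val t) = A])%card.
Proof.
apply: (@f2_independent_card_le _ _ (fun s t => coordinate cS' rS' t (val s))).
  by move=> s; have [l [_ lP _]] := coordinate_support cS' rS' (val s);
    exists l => t; rewrite lP.
move=> x l /= xA lA xl; pose g := val x * \prod_(s <- l) val s.
have sumE t : f2_sum (fun s t => coordinate cS' rS' t (val s)) (x :: l) t =
    coordinate cS' rS' t g.
  rewrite /f2_sum big_cons coordinate_hom parity_hom_prod //; exact: coordinate_hom.
have xg : coordinate cS rS x g.
  rewrite coordinate_hom coordinate_gen eqxx parity_hom_prod; last exact: coordinate_hom.
  rewrite big_seq big1 // => s sl; rewrite coordinate_gen.
  by apply: contraNF xl => /eqP <-.
have [l' [_ lP' phi_l']] := coordinate_support cS' rS' g.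
move: xg; rewrite phi_l'; last exact: coordinate_hom.
case/big_addb_ex => t; rewrite -lP' => tg xt.
exists t; last by rewrite sumE.
apply/seteqP; split.
  rewrite -xA; apply: compatible_coordinate xt.
  exact/invol_involutive_class/coxeter_invol.
move: tg; rewrite -sumE => /big_addb_ex[s sl ts].
have <- : compatible (val s) = A by move: sl; rewrite inE => /predU1P[->|/lA].
apply: compatible_coordinate ts.
exact/invol_involutive_class/coxeter_invol.
Qed.

End TwoCoxeterSets.

Lemma right_angled_types_isomorphic (W : groupType) (S S' : set W) :
  coxeter_set S -> at_most2 S -> coxeter_set S' -> at_most2 S' ->
  types_isomorphic S S'.
Proof.
move=> cS rS cS' rS'.
have [|f bij_f fP] := @card_eq_fibers_bijection (set_type S) (set_type S') _
  (fun s => compatible (val s)) (fun t => compatible (val t)).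
  by move=> A; apply: Cantor_Bernstein; apply: compatible_class_card_le.
exists f; split=> // s t; rewrite !coxeter_typeE // (bij_eq bij_f).
case: ifP => // _; congr (if _ then _ else _).
have inv_t : involutive_class (val t) by exact/invol_involutive_class/coxeter_invol.
have inv_ft : involutive_class (val (f t)) by exact/invol_involutive_class/coxeter_invol.
have inv_s : involutive_class (val s) by exact/invol_involutive_class/coxeter_invol.
(* [fP] replaces only the first argument of [compatible]; its symmetry lets [s] and [t] be replaced
   in turn. *)
apply/idP/idP.
  move/(adj_compatible cS' rS'); rewrite fP => /(compatibleC inv_s).
  by rewrite fP => /(compatibleC inv_t) /(adj_compatible cS rS).
move/(adj_compatible cS rS)/(compatibleC inv_s); rewrite -fP.
by move/(compatibleC inv_ft); rewrite -fP => /(adj_compatible cS' rS').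
Qed.

(** * From isomorphic types to automorphisms *)

Section TypeTransport.
Variables (W : groupType) (S S' : set W).
Hypotheses (cS : coxeter_set S) (cS' : coxeter_set S').
Variable f : set_type S -> set_type S'.
Hypothesis typef : forall s t, coxeter_type (f s) (f t) = coxeter_type s t.

Definition word_map (w : word (set_type S)) : word (set_type S') :=
  [seq (f l.1, l.2) | l <- w].

Lemma word_map_equiv u v : word_equiv (@coxeter_relators W S) u v ->
  word_equiv (@coxeter_relators W S') (word_map u) (word_map v).
Proof.
elim=> {u v} [u|u v _ IH|u v w _ IH1 _ IH2|u u' v v' _ IH1 _ IH2|x b|r].
- exact: word_equiv_refl.
- exact: word_equiv_sym.
- exact: word_equiv_trans IH2.
- by rewrite /word_map !map_cat; apply: word_equiv_cat.
- exact: word_equiv_cancel.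
- case=> s [t [m [stm ->]]]; apply: word_equiv_rel; exists (f s), (f t), m.
  split; first by rewrite typef.
  by rewrite /word_map map_flatten map_nseq.
Qed.

Lemma type_transport : exists a : W -> W, forall w,
  a (word_eval (fun s => val s) w) = word_eval (fun s => val s) (word_map w).
Proof.
have [word_of wordK] := choice cS.2.1.
exists (fun g => word_eval (fun s => val s) (word_map (word_of g))) => w.
by apply/cS'.2.2/word_map_equiv/cS.2.2; rewrite wordK.
Qed.

End TypeTransport.

Lemma types_isomorphic_automorphic (W : groupType) (S S' : set W) :
  coxeter_set S -> coxeter_set S' -> types_isomorphic S S' -> automorphic_sets S S'.
Proof.
move=> cS cS' [f [[f' fK f'K] typef]].
have typef' s t : coxeter_type (f' s) (f' t) = coxeter_type s t.
  by rewrite -typef !f'K.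
have [a aE] := type_transport cS cS' typef.
have [b bE] := type_transport cS' cS typef'.
have aM : {morph a : x y / x * y}.
  move=> x y; have [u <-] := cS.2.1 x; have [w <-] := cS.2.1 y.
  by rewrite -word_eval_cat !aE /word_map map_cat word_eval_cat.
have bij_a : bijective a.
  exists b => x.
    have [u <-] := cS.2.1 x; rewrite aE bE /word_map -map_comp map_id_in // => -[s e] _ /=.
    by rewrite fK.
  have [u <-] := cS'.2.1 x; rewrite bE aE /word_map -map_comp map_id_in // => -[s e] _ /=.
  by rewrite f'K.
have a_gen s : a (val s) = val (f s).
  have := aE [:: (s, true)]; rewrite !word_eval_cons !word_eval_nil !mulg1.
  by rewrite /letter_eval.
pose alpha : {multiplicative W -> W} := HB.pack a (isMultiplicative.Build W W a aM).
exists alpha; split=> //; apply/seteqP; split=> [_ [s Ss <-]|s' Ss'].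
  have -> : alpha s = val (f (SigSub (mem_set Ss))) by exact: a_gen (SigSub _).
  exact: set_valP.
exists (val (f' (SigSub (mem_set Ss')))); first exact: set_valP.
by rewrite /= a_gen f'K.
Qed.

Theorem mainTheorem2 (W : groupType) (hW : right_angled_coxeter_group W) :
  rigid W /\
  (forall S S' : set W, coxeter_set S -> coxeter_set S' ->
     types_isomorphic S S').
Proof.
have [R [cR /right_angled_at_most2 rR]] := hW.
(* The torsion bound obtained from [R] concerns all of [W], so it applies to products of generators
   from any Coxeter set. *)
have at_most2W (S : set W) : coxeter_set S -> at_most2 S.
  move=> cS s t m E; have [m0 stm] := elt_order_gt0 E.
  apply: (elt_order_min E) => //; rewrite expg2.
  exact: (torsion_invol cR rR m0 stm).
have iso (S S' : set W) : coxeter_set S -> coxeter_set S' -> types_isomorphic S S'.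
  by move=> cS cS'; apply: right_angled_types_isomorphic => //; apply: at_most2W.
by split=> // S S' cS cS'; apply: types_isomorphic_automorphic => //; apply: iso.
Qed.
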